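(* For any Kan cubical group $G$, $$\pi_n(G)=H_n(M(G)),\quad n\ge 0.$$
   Context: A cubical object $X$ in a category is a family of objects $(X_n)_{n\ge0}$ with faces $\partial_i^0,\partial_i^1: X_n\to X_{n-1}$ and degeneracies $s_i: X_{n-1}\to X_n$ ($1\le i\le n$) such that $\partial_i^\alpha\partial_j^\varepsilon=\partial_{j-1}^\varepsilon\partial_i^\alpha$ for $i<j$; $s_is_j=s_{j+1}s_i$ for $i\le j$; and $\partial_i^\alpha s_j=s_{j-1}\partial_i^\alpha$ if $i<j$, $=\mathrm{id}$ if $i=j$, $=s_j\partial_{i-1}^\alpha$ if $i>j$ ($\alpha,\varepsilon\in\{0,1\}$). A cubical set (group) is a cubical object in sets (groups). A cubical set $X$ is Kan if for any $n\ge1$, any $(i,\alpha)\in\{1,\dots,n\}\times\{0,1\}$ and any $2n-1$ elements $x_j^\varepsilon\in X_{n-1}$ ($1\le j\le n$, $\varepsilon\in\{0,1\}$, $(j,\varepsilon)\ne(i,\alpha)$) with $\partial_j^\varepsilon x_k^\omega=\partial_{k-1}^\omega x_j^\varepsilon$ for $1\le j<k\le n$, $\varepsilon,\omega\in\{0,1\}$, $(j,\varepsilon),(k,\omega)\ne(i,\alpha)$, there is $x\in X_n$ with $\partial_j^\varepsilon x=x_j^\varepsilon$ for all $(j,\varepsilon)\neq(i,\alpha)$. A Kan cubical group is a cubical group whose underlying cubical set is Kan. For a Kan cubical set $X$ with basepoint $\psi\in X_0$ (the degeneracies of $\psi$ in each $X_n$ are also denoted $\psi$), put $\widetilde X_0=X_0$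 and, for $n>0$, $\widetilde X_n=\{x\in X_n: \partial_j^\varepsilon x=\psi \text{ for all } 1\le j\le n,\ \varepsilon\in\{0,1\}\}$. For $x,y\in\widetilde X_n$ write $x\sim y$ iff there is $z\in X_{n+1}$ with $\partial_1^0z=x$, $\partial_1^1z=y$ and $\partial_j^\varepsilon z=\psi$ for $2\le j\le n+1$, $\varepsilon\in\{0,1\}$ (equivalently, iff there is $w\in X_{n+1}$ with $\partial_{n+1}^0w=x$, $\partial_{n+1}^1w=y$ and all other faces $\psi$); this is an equivalence relation. Set $\pi_n(X,\psi)=\widetilde X_n/\sim$. For $n\ge1$ it is a group under $[x]\bullet[y]=[\partial_1^1z]$, where $z\in X_{n+1}$ is any element (existing by the Kan condition) with $\partial_1^0z=x$, $\partial_2^0z=\psi$, $\partial_2^1z=y$ and $\partial_j^\varepsilon z=\psi$ for $3\le j\le n+1$, $\varepsilon\in\{0,1\}$; this depends only on the classes of $x$ and $y$. For a Kan cubical group $G$, $\pi_n(G)=\pi_n(G,1)$, where $1$ is the unit of $G_0$. For a cubical group $G$, the Moore chain complex $M(G)$ is the chain complex of (not necessarily abelian) groups with $M_0(G)=G_0$, $M_n(G)=\left(\bigcap_{i=1}^n\ker\partial_i^1\right)\cap\left(\bigcap_{i=1}^{n-1}\ker\partial_i^0\right)$ for $n>0$ (kernels of maps $G_n\to G_{n-1}$), and differential $\partial_n^0: M_n(G)\to M_{n-1}(G)$. The image of each differential is a normal subgroup, and $H_n(M(G))=\ker(\partial_n^0: M_n(G)\to M_{n-1}(G))/\mathrm{Im}(\partial_{n+1}^0: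 M_{n+1}(G)\to M_n(G))$, where for $n=0$ the kernel is understood to be $M_0(G)$. Both sides are quotients of the same set: $\widetilde G_n=\ker(\partial_n^0: M_n(G)\to M_{n-1}(G))$ for $n\ge 1$, and $\widetilde G_0=G_0=M_0(G)$; for $n\ge1$ the equality is one of groups. *)

(* Defs.v *)
From mathcomp Require Import all_boot.
From mathcomp Require Import boolp classical_sets.
Set Implicit Arguments.
Unset Strict Implicit.
Unset Printing Implicit Defensive.
Local Open Scope classical_set_scope.
Local Open Scope group_scope.

(* Directions are numbered from 0: the ordinal i : 'I_n.+1 stands for the
   direction i + 1 of an (n+1)-dimensional cell, so that ord0 and ord_max are
   the first and the last directions. The sign in {0, 1} is a boolean,
   false for 0 and true for 1. When a formula uses one direction
   in two different dimensions, or shifts it by one, each occurrence is a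
   separate ordinal, tied to the others by equations between values. *)
Record cubical_laws (X : nat -> Type)
    (d : forall n, 'I_n.+1 -> bool -> X n.+1 -> X n)
    (s : forall n, 'I_n.+1 -> X n -> X n.+1) : Prop := CubicalLaws {
  face_face : forall n (i jp : 'I_n.+1) (iw j : 'I_n.+2) (a e : bool)
      (x : X n.+2),
    i < j -> iw = i :> nat -> j = jp.+1 :> nat ->
    d n i a (d n.+1 j e x) = d n jp e (d n.+1 iw a x);
  degen_degen : forall n (i j : 'I_n.+1) (iw js : 'I_n.+2) (x : X n),
    i <= j -> iw = i :> nat -> js = j.+1 :> nat ->
    s n.+1 iw (s n j x) = s n.+1 js (s n i x);
  face_degen_lt : forall n (i j : 'I_n.+2) (io jp : 'I_n.+1) (a : bool)
      (x : X n.+1),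
    i < j -> io = i :> nat -> j = jp.+1 :> nat ->
    d n.+1 i a (s n.+1 j x) = s n jp (d n io a x);
  face_degen_eq : forall n (i : 'I_n.+1) (a : bool) (x : X n),
    d n i a (s n i x) = x;
  face_degen_gt : forall n (i j : 'I_n.+2) (ip jo : 'I_n.+1) (a : bool)
      (x : X n.+1),
    j < i -> i = ip.+1 :> nat -> jo = j :> nat ->
    d n.+1 i a (s n.+1 j x) = s n jo (d n ip a x)
}.

Record cubicalSet := CubicalSet {
  cell :> nat -> Type;
  face : forall n, 'I_n.+1 -> bool -> cell n.+1 -> cell n;
  degen : forall n, 'I_n.+1 -> cell n -> cell n.+1;
  cubicalP : cubical_laws face degen
}.

Record cubicalGroup := CubicalGroup {
  gcell : nat -> groupType;
  gface : forall n, 'I_n.+1 -> bool ->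
    UMagmaMorphism.type (gcell n.+1) (gcell n);
  gdegen : forall n, 'I_n.+1 ->
    UMagmaMorphism.type (gcell n) (gcell n.+1);
  gcubicalP : cubical_laws (X := gcell)
    (fun n i a => gface (n := n) i a) (fun n i => gdegen (n := n) i)
}.

Coercion underlying_cubicalSet (G : cubicalGroup) : cubicalSet :=
  CubicalSet (gcubicalP G).

Section Kan.
Variable X : cubicalSet.

(* The family x is total, but its value at the missing face p is never used. *)
Definition open_box n : ('I_n.+1 -> bool -> X n) -> 'I_n.+1 * bool -> Prop :=
  match n with
  | 0 => fun _ _ => True
  | m.+1 => fun x p =>
      forall (j k : 'I_m.+2) (jo kp : 'I_m.+1) (e w : bool),
        j < k -> jo = j :> nat -> k = kp.+1 :> nat ->
        (j, e) != p -> (k, w) != p ->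
        face jo e (x k w) = face kp w (x j e)
  end.

Definition Kan : Prop :=
  forall n (p : 'I_n.+1 * bool) (x : 'I_n.+1 -> bool -> X n),
    open_box x p ->
    exists z : X n.+1, forall j e, (j, e) != p -> face j e z = x j e.

End Kan.

Section HomotopyGroups.
Variables (X : cubicalSet) (psi : X 0).

(* All iterated degeneracies of psi in X n coincide, by degen_degen. *)
Fixpoint base n : X n :=
  match n with 0 => psi | m.+1 => degen ord0 (base m) end.

Definition spherical n : set (X n) :=
  match n with
  | 0 => setT
  | m.+1 => [set x | forall (j : 'I_m.+1) e, face j e x = base m]
  end.

Definition homotopic n (x y : X n) : Prop :=
  exists z : X n.+1,
    [/\ face ord0 false z = x,
        face ord0 true z = y &
        forall (j : 'I_n.+1) e, 0 < j -> face j e z = base n].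

Definition homotopy_class n (x : X n) : set (X n) :=
  [set y | spherical y /\ homotopic x y].

Definition homotopy_group n : set (set (X n)) := [set homotopy_class x | x in @spherical n].

Definition homotopy_filler m (x y : X m.+1) (z : X m.+2) : Prop :=
  [/\ face ord0 false z = x,
      face (lift ord0 ord0) false z = base m.+1,
      face (lift ord0 ord0) true z = y &
      forall (j : 'I_m.+2) e, 1 < j -> face j e z = base m.+1].

(* The product on classes, for cells of positive dimension: the union of the
   classes [d_1^1 z] over all representatives x of A and y of B and all
   fillers z. When X is Kan and A, B are in homotopy_group, this is the single
   class obtained from any choice of x, y and z. *)
Definition homotopy_mul m (A B : set (X m.+1)) : set (X m.+1) :=
  [set w | exists x y z, [/\ A x, B y, homotopy_filler x y z &
                             homotopy_class (face ord0 true z) w]].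

End HomotopyGroups.

Section MooreComplex.
Variable G : cubicalGroup.

Definition Moore n : set (gcell G n) :=
  match n with
  | 0 => setT
  | m.+1 => [set x | (forall i : 'I_m.+1, gface G i true x = 1) /\
                     (forall i : 'I_m.+1, i < m -> gface G i false x = 1)]
  end.

Definition Moore_diff n : gcell G n.+1 -> gcell G n := gface G ord_max false.

Definition cycles n : set (gcell G n) :=
  match n with
  | 0 => Moore (n := 0)
  | m.+1 => [set x | Moore x /\ Moore_diff x = 1]
  end.

Definition boundaries n : set (gcell G n) :=
  [set Moore_diff x | x in @Moore n.+1].

Definition homology_class n (x : gcell G n) : set (gcell G n) :=
  [set x * b | b in @boundaries n].

Definition homology n : set (set (gcell G n)) :=
  [set homology_class x | x in @cycles n].

(* On cosets of the normal subgroup of boundaries, the set of all products is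
   the product of the quotient group. *)
Definition homology_mul n (A B : set (gcell G n)) : set (gcell G n) :=
  [set a * b | a in A & b in B].

End MooreComplex.

Definition group_pi (G : cubicalGroup) n : set (set (gcell G n)) :=
  @homotopy_group G 1 n.

Definition group_pi_mul (G : cubicalGroup) m (A B : set (gcell G m.+1)) :
    set (gcell G m.+1) :=
  @homotopy_mul G 1 m A B.

Arguments homology : clear implicits.
Arguments group_pi : clear implicits.

(* Main.v *)
(* Spherical cells are exactly the Moore cycles. If z is a homotopy from x to y
   along the first direction, then z^-1 * s_1 y has all faces 1 except
   d_1^0 = x^-1 * y; so x ~ y iff x^-1 * y is the only nontrivial face, in
   position (1, 0), of some cell, while boundaries are the only nontrivial
   faces in position (n + 1, 0). An open box with a single nontrivial face
   moves that face from any direction to any other, so the two notions agree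
   and homotopy classes are cosets of the boundaries.

   For the product, let z be a filler for x and y. Then u = (s_1 x)^-1 * z has
   the faces r = x^-1 * d_1^1 z in position (1, 1), y in position (2, 1) and 1
   elsewhere. Filling a box made of two copies of u gives a cell t with the
   face y in both positions, and t^-1 * u shows that y^-1 * r is a boundary,
   that is, d_1^1 z lies in x * y * boundaries. *)
Require Import Defs.
From mathcomp Require Import all_boot.
From mathcomp Require Import boolp classical_sets.
From mathcomp Require Import zify.
Set Implicit Arguments.
Unset Strict Implicit.
Unset Printing Implicit Defensive.
Local Open Scope classical_set_scope.
Local Open Scope group_scope.

(** * Relative positions of two distinct directions *)

Lemma lift_sym n (p q : 'I_n.+2) (i : 'I_n.+1) :
  lift p i = q -> exists k, lift q k = p.
Proof.
move=> <-; case: (unliftP (lift p i) p) => [k pE|pE]; first by exists k.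
by have := neq_lift p i; rewrite -pE eqxx.
Qed.

(** Supplies the two directions of the box in [move_filling_face]; in each case one position is
    shifted by one, which makes the directions distinct. *)
Lemma lift_pair n (i k : 'I_n.+1) :
  exists p q : 'I_n.+2, lift p i = q /\ lift q k = p.
Proof.
have [ik|ki] := ltnP i k.
  exists (lift ord0 k), (widen_ord (leqnSn _) i).
  by split; apply: val_inj; rewrite /= /bump; lia.
exists (widen_ord (leqnSn _) k), (lift ord0 i).
by split; apply: val_inj; rewrite /= /bump; lia.
Qed.

Section CubicalGroup.
Variable G : cubicalGroup.
Implicit Types n m : nat.

(** A form of the face relation covering both orders of the directions: [i] is the position of [q]
    after deleting [p], and [k] that of [p] after deleting [q]. *)
Lemma gface_gface n (p q : 'I_n.+2) (i k : 'I_n.+1) a e (x : gcell G n.+2) :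
  lift p i = q -> lift q k = p ->
  gface G k a (gface G q e x) = gface G i e (gface G p a x).
Proof.
have [FF _ _ _ _] := gcubicalP G.
move=> pq qp; have := congr1 val pq; have := congr1 val qp.
rewrite /= /bump => vqp vpq.
have [ltpq|leqp] := ltnP p q; first by apply: FF; lia.
by apply/esym; apply: FF; lia.
Qed.

(** * Spherical cells, cycles and boundaries *)

Lemma base1 n : @base G 1 n = 1 :> gcell G n.
Proof. by elim: n => //= n; rewrite /base => ->; rewrite gmulf1. Qed.

Lemma sphericalE n (x : gcell G n.+1) :
  @spherical G 1 n.+1 x <-> forall (j : 'I_n.+1) e, gface G j e x = 1.
Proof. by split=> Sx j e; have := Sx j e; rewrite base1. Qed.

Lemma cycles_spherical n : @cycles G n = @spherical G 1 n.
Proof.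
case: n => // n; apply/seteqP; split=> x.
  move=> [[x1 x0] xm]; apply/sphericalE => j [] //.
  have [/x0 //|nj] := ltnP j n.
  by rewrite (_ : j = ord_max) //; apply: val_inj => /=; have := ltn_ord j; lia.
by move/sphericalE => Sx; split => //; apply: Sx.
Qed.

Definition is_filling_face n (k : 'I_n.+1) a (c : gcell G n) (w : gcell G n.+1) :=
  gface G k a w = c /\
  forall j e, (j, e) != (k, a) -> gface G j e w = 1.

Lemma boundariesE n (c : gcell G n) :
  boundaries c <-> exists w, is_filling_face ord_max false c w.
Proof.
split=> [[w [w1 w0] <-]|[w [wc w1]]].
  exists w; split=> // j [] jP; first exact: w1.
  apply: w0; move: jP; rewrite xpair_eqE andbT -val_eqE /=.
  by have := ltn_ord j; lia.
exists w => //; split=> [i|i lti]; apply: w1; rewrite xpair_eqE ?andbF //.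
by rewrite andbT -val_eqE /=; lia.
Qed.


(** Each face of [c] is also a face of a face of [w] in another direction, which is 1. *)
Lemma filling_face_spherical n (k : 'I_n.+1) a (c : gcell G n) w :
  is_filling_face k a c w -> @spherical G 1 n c.
Proof.
move=> [<- w1]; case: n k c w w1 => // n k _ w w1.
apply/sphericalE => j e; have [i ji] := lift_sym (erefl (lift k j)).
rewrite (gface_gface e a w ji erefl) w1 ?gmulf1 //.
by rewrite xpair_eqE eq_sym (negPf (neq_lift _ _)).
Qed.

Lemma boundaries_spherical n (c : gcell G n) :
  boundaries c -> @spherical G 1 n c.
Proof. by move=> /boundariesE[w]; apply: filling_face_spherical. Qed.

Lemma sphericalM n (x y : gcell G n) :
  @spherical G 1 n x -> @spherical G 1 n y -> @spherical G 1 n (x * y).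
Proof.
case: n x y => // n x y /sphericalE Sx /sphericalE Sy.
by apply/sphericalE => j e; rewrite gmulfM Sx Sy mulg1.
Qed.

Lemma boundariesM n (b c : gcell G n) :
  boundaries b -> boundaries c -> boundaries (b * c).
Proof.
move=> /boundariesE[v [<- v1]] /boundariesE[w [<- w1]]; apply/boundariesE.
exists (v * w); split=> [|j e je]; first exact: gmulfM.
by rewrite gmulfM v1 // w1 // mulg1.
Qed.

Lemma boundariesV n (b : gcell G n) : boundaries b -> boundaries b^-1.
Proof.
move=> /boundariesE[v [<- v1]]; apply/boundariesE.
exists v^-1; split=> [|j e je]; first exact: gmulfV.
by rewrite gmulfV v1 // invg1.
Qed.

(** * Degeneracies of spherical cells, and homotopies *)

Lemma gface_degen_eq n (i : 'I_n.+1) e (x : gcell G n) :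
  gface G i e (gdegen G i x) = x.
Proof. by have [_ _ _ + _] := gcubicalP G; apply. Qed.

(** Such a face is a degeneracy of a face of [x], hence of 1; in dimension 0 there is no second
    direction. *)
Lemma gface_degen_spherical n (i j : 'I_n.+1) e (x : gcell G n) :
  @spherical G 1 n x -> j != i -> gface G j e (gdegen G i x) = 1.
Proof.
case: n i j x => [|n] i j x; first by rewrite !ord1.
move=> /sphericalE Sx; rewrite -val_eqE neq_ltn /= => /orP[ji|ij].
- have [_ _ FD _ _] := gcubicalP G.
  have i0 : i.-1 < n.+1 by have := ltn_ord i; lia.
  have j0 : j < n.+1 by have := ltn_ord i; lia.
  rewrite (FD _ _ _ (Ordinal j0) (Ordinal i0)) ?Sx ?gmulf1 //=; lia.
- have [_ _ _ _ FD] := gcubicalP G.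
  have i0 : i < n.+1 by have := ltn_ord j; lia.
  have j0 : j.-1 < n.+1 by have := ltn_ord j; lia.
  rewrite (FD _ _ _ (Ordinal j0) (Ordinal i0)) ?Sx ?gmulf1 //=; lia.
Qed.

Lemma homotopic_filling n (x y : gcell G n) : @spherical G 1 n y ->
  @homotopic G 1 n x y <-> exists w, is_filling_face ord0 false (x^-1 * y) w.
Proof.
move=> Sy; split=> [[z [zx zy z1]]|[w [wxy w1]]].
  exists (z^-1 * gdegen G ord0 y); split=> [|j e].
    by rewrite gmulfM gmulfV gface_degen_eq; congr (_^-1 * _).
  rewrite gmulfM gmulfV; have [->|j0] := eqVneq j ord0.
    case: e => // _; rewrite gface_degen_eq.
    by rewrite (_ : gface G _ _ z = y) // mulVg.
  rewrite gface_degen_spherical // mulg1 => _.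
  have := z1 j e; rewrite base1 /= => -> //; first exact: invg1.
  by rewrite lt0n.
(* Solves [w = z^-1 * s_1 y] for [z]. *)
exists (gdegen G ord0 y * w^-1).
rewrite base1 /=; split; rewrite ?gmulfM ?gmulfV ?gface_degen_eq.
- by rewrite wxy invgM invgK mulgA mulgV mul1g.
- by rewrite w1 // invg1 mulg1.
move=> j e j0; have jn0 : j != ord0 by rewrite -lt0n in j0 *.
rewrite gmulfM gmulfV gface_degen_spherical // w1 ?invg1 ?mulg1 //.
by rewrite xpair_eqE (negPf jn0).
Qed.

(** * Consequences of the Kan condition: homotopy classes as cosets *)

Hypothesis G_Kan : Kan G.

(** Compatibility is stated through [lift], as in [gface_gface], so that boxes can be checked
    without ordering their directions. *)
Lemma gKan n (q : 'I_n.+2) c (x : 'I_n.+2 -> bool -> gcell G n.+1) :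
  (forall (j k : 'I_n.+2) (i l : 'I_n.+1) a e,
     lift j i = k -> lift k l = j -> (j, a) != (q, c) -> (k, e) != (q, c) ->
     gface G l a (x k e) = gface G i e (x j a)) ->
  exists t : gcell G n.+2, forall j e, (j, e) != (q, c) -> gface G j e t = x j e.
Proof.
move=> xP; have := @G_Kan n.+1 (q, c) x; apply=> j k jo kp e w jk jojE kE jq kq.
by apply: xP => //; apply: val_inj; rewrite /= /bump; lia.
Qed.

Lemma move_filling_face n (i k : 'I_n.+1) (c : gcell G n) :
  (exists w, is_filling_face i false c w) -> exists w, is_filling_face k false c w.
Proof.
(* [w] goes in direction [p] and direction [q] is left open; they meet in [c], at position [i] of
   [w] and position [k] of the missing face. *)
move=> [w [wc w1]]; have [p [q [pq qp]]] := lift_pair i k.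
pose x (j : 'I_n.+2) e : gcell G n.+1 := if (j, e) == (p, false) then w else 1.
(* Only the face [c] of [w] can be nontrivial, and it borders the missing face; along every
   prescribed face [w] is 1. *)
have wface j a l : lift p l = j -> (j, a) != (q, false) -> gface G l a w = 1.
  move=> pl jq; apply: w1; apply: contraNneq jq => -[li ->].
  by rewrite -pl li pq.
have [j1 j2 i1 l1 a e lj lk jq kq|t tx] := @gKan n q false x.
  rewrite /x; have [[kE eE]|_] := eqVneq (j2, e) (p, false);
    have [[jE aE]|_] := eqVneq (j1, a) (p, false).
  - by have := neq_lift j1 i1; rewrite lj kE jE eqxx.
  - by rewrite gmulf1 (wface j1) // -kE.
  - by rewrite gmulf1 (wface j2) // -jE.
  - by rewrite !gmulf1.
have pNq : p != q by rewrite -pq neq_lift.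
exists (gface G q false t); split=> [|j e jk].
  rewrite (gface_gface false false t pq qp) tx ?xpair_eqE ?(negPf pNq) //.
  by rewrite /x eqxx.
have [i' qi'] := lift_sym (erefl (lift q j)).
rewrite (gface_gface e false t qi' erefl) tx.
  rewrite /x ifN ?gmulf1 //; apply: contraNneq jk => -[jE ->].
  by rewrite (_ : j = k) //; apply: (@lift_inj _ q); rewrite jE qp.
by rewrite xpair_eqE eq_sym (negPf (neq_lift _ _)).
Qed.

Lemma homotopic_boundaries n (x y : gcell G n) : @spherical G 1 n y ->
  @homotopic G 1 n x y <-> boundaries (x^-1 * y).
Proof.
move=> Sy; apply: (iff_trans (homotopic_filling x Sy)).
apply: (iff_trans _ (iff_sym (boundariesE _))).
by split; apply: move_filling_face.
Qed.

Lemma homotopy_classE n (x : gcell G n) : @spherical G 1 n x ->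
  @homotopy_class G 1 n x = homology_class x.
Proof.
move=> Sx; apply/seteqP; split=> [y [Sy /(homotopic_boundaries _ Sy) b]|_ [b Bb <-]].
  by exists (x^-1 * y) => //; rewrite mulgA mulgV mul1g.
have Sxb : @spherical G 1 n (x * b).
  by apply: sphericalM => //; apply: boundaries_spherical.
split=> //; apply/(homotopic_boundaries _ Sxb).
by rewrite mulgA mulVg mul1g.
Qed.

(** * Fillers and the product *)

Definition is_corner n (r y : gcell G n.+1) (u : gcell G n.+2) :=
  [/\ gface G ord0 true u = r, gface G (lift ord0 ord0) true u = y &
      forall (j : 'I_n.+2) e, ~~ (e && (j <= 1)) -> gface G j e u = 1].

(* A Kan substitute for a connection on y: in a box of dimension one more, put
   u on the top faces in the first two directions and 1 elsewhere; these two
   copies of u agree along their common face r, and the missing top face in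
   the third direction is the required corner. *)
Lemma corner_connection n (r y : gcell G n.+1) u :
  is_corner r y u -> exists t, is_corner y y t.
Proof.
move=> [ur uy u1]; pose q : 'I_n.+3 := lift ord0 (lift ord0 ord0).
pose x (j : 'I_n.+3) e : gcell G n.+2 := if e && (j <= 1) then u else 1.
(* If [a] is true, [j] is none of 0, 1 and the open direction 2, so its position [l] after deleting
   [k] is at least 2. *)
have uface (j k : 'I_n.+3) l a : lift k l = j -> k <= 1 ->
    (j, a) != (q, true) -> ~~ (a && (j <= 1)) -> gface G l a u = 1.
  move=> /(congr1 val); rewrite xpair_eqE -val_eqE /= /bump => jE k1 jq ja.
  by apply: u1; case: a jq ja => //=; lia.
have [j k i l a e ji kl jq kq|t tx] := @gKan n.+1 q true x.
  rewrite /x; case: ifPn => [/andP[eT k1]|ke]; case: ifPn => [/andP[aT j1]|ja].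
  - rewrite eT aT; congr (gface G _ _ _); apply: val_inj.
    have := congr1 val ji; have := congr1 val kl.
    by rewrite /= /bump; lia.
  - by rewrite gmulf1 (uface j k).
  - by rewrite gmulf1 (uface k j).
  - by rewrite !gmulf1.
have tface (j : 'I_n.+2) e : gface G j e (gface G q true t) =
    if e && (j <= 1) then y else 1.
  have [i ji] := lift_sym (erefl (lift q j)).
  rewrite (gface_gface e true t ji erefl) tx; last first.
    by rewrite xpair_eqE eq_sym (negPf (neq_lift _ _)).
  have := congr1 val ji; rewrite /= /bump /= => iE.
  rewrite /x /= /bump /= (_ : (_ <= 1) = (j <= 1)); last by lia.
  case: ifP => [/andP[_ j1]|_]; last by rewrite gmulf1.
  (* Deleting direction 0 or 1 moves [q] from 2 to position 1, where the upper face of [u] is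
     [y]. *)
  rewrite (_ : i = lift ord0 ord0) //; apply: val_inj.
  by rewrite /= /bump /=; lia.
exists (gface G q true t); split=> [||j e je]; rewrite tface //.
by rewrite (negPf je).
Qed.

Lemma corner_boundaries n (r y : gcell G n.+1) u :
  is_corner r y u -> boundaries (y^-1 * r).
Proof.
move=> uP; have [t [tr ty t1]] := corner_connection uP.
have [ur uy u1] := uP.
have vP : is_filling_face ord0 true (y^-1 * r) (t^-1 * u).
  split=> [|j e je]; rewrite gmulfM gmulfV; first by rewrite tr ur.
  have [/andP[eT j1]|ne] := boolP (e && (j <= 1)); last first.
    by rewrite t1 // u1 // mulVg.
  rewrite eT (_ : j = lift ord0 ord0); first by rewrite ty uy mulVg.
  apply: val_inj; move: je; rewrite eT xpair_eqE eqxx andbT -val_eqE /=.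
  by rewrite /bump /=; lia.
have Sv := filling_face_spherical vP; have [vr v1] := vP.
(* The nontrivial face has sign true, but boundaries use sign false; reading [t^-1 * u] as a
   homotopy from 1 to [y^-1 * r] changes the sign. *)
have -> : y^-1 * r = 1^-1 * (y^-1 * r) by rewrite invg1 mul1g.
apply/(homotopic_boundaries _ Sv); exists (t^-1 * u); split=> //.
  exact: v1.
by move=> j e j0; rewrite base1; apply: v1; rewrite xpair_eqE -val_eqE /=; lia.
Qed.

Lemma homotopy_fillerE n (x y : gcell G n.+1) z :
  @homotopy_filler G 1 n x y z <->
  [/\ gface G ord0 false z = x, gface G (lift ord0 ord0) true z = y &
      forall (j : 'I_n.+2) e, 0 < j -> (j, e) != (lift ord0 ord0, true) ->
        gface G j e z = 1].
Proof.
rewrite /homotopy_filler base1 /=.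
split=> [[z0 z1 zy zj]|[z0 zy zj]]; split=> //.
- move=> j e j0 je; have [j1|j1] := ltnP 1 j; first exact: zj.
  have jE : j = lift ord0 ord0.
    by apply: val_inj; rewrite /= /bump /=; lia.
  by move: je; rewrite jE xpair_eqE eqxx /=; case: e.
- exact: zj.
- move=> j e j1; apply: zj; first by lia.
  by rewrite xpair_eqE -val_eqE /= /bump /=; lia.
Qed.

(** All prescribed faces are spherical, so both sides of every compatibility equation are 1. *)
Lemma homotopy_filler_exists n (x y : gcell G n.+1) :
  @spherical G 1 n.+1 x -> @spherical G 1 n.+1 y ->
  exists z, @homotopy_filler G 1 n x y z.
Proof.
move=> /sphericalE Sx /sphericalE Sy.
pose f (j : 'I_n.+2) e : gcell G n.+1 :=
  if (j, e) == (ord0, false) then x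
  else if (j, e) == (lift ord0 ord0, true) then y else 1.
have f1 j e l b : gface G l b (f j e) = 1.
  by rewrite /f; case: ifP => _; [|case: ifP => _]; rewrite ?Sx ?Sy ?gmulf1.
have [|z zf] := @gKan n ord0 true f; first by move=> *; rewrite !f1.
exists z; apply/homotopy_fillerE; split; rewrite ?zf //.
move=> j e j0 je; have jn0 : (j == ord0) = false by rewrite -val_eqE /=; lia.
by rewrite zf /f ?xpair_eqE jn0 // -xpair_eqE (negPf je).
Qed.

(** Holds for every filler, so it serves both for the arbitrary [z] in [homotopy_mul] and for one
    obtained from the Kan condition. *)
Lemma homotopy_filler_mul n (x y : gcell G n.+1) z :
  @spherical G 1 n.+1 x -> @homotopy_filler G 1 n x y z ->
  exists2 b, boundaries b & gface G ord0 true z = x * y * b.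
Proof.
move=> Sx /homotopy_fillerE[zx zy z1].
have /corner_boundaries Bb : is_corner (x^-1 * gface G ord0 true z) y
    ((gdegen G ord0 x)^-1 * z).
  split=> [||j e je]; rewrite gmulfM gmulfV ?gface_degen_eq //.
    by rewrite gface_degen_spherical // invg1 mul1g.
  have [jE|j0] := eqVneq j ord0.
    by move: je; rewrite jE; case: e => // _; rewrite gface_degen_eq zx mulVg.
  rewrite gface_degen_spherical // invg1 mul1g z1 ?lt0n //.
  by apply: contraNneq je => -[-> ->].
exists (y^-1 * (x^-1 * gface G ord0 true z)) => //.
by rewrite -mulgA [y * _]mulgA mulgV mul1g mulgA mulgV mul1g.
Qed.

End CubicalGroup.

Theorem proposition2p8 (G : cubicalGroup) (G_Kan : Kan G) :
  (forall n : nat, group_pi G n = homology G n) /\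
  (forall (m : nat) (A B : set (gcell G m.+1)),
     group_pi G m.+1 A -> group_pi G m.+1 B ->
     group_pi_mul A B = homology_mul A B).
Proof.
split=> [n|m A B [x Sx <-] [y Sy <-]].
  rewrite /group_pi /homotopy_group /homology cycles_spherical.
  by apply: eq_imagel => x; apply: homotopy_classE.
rewrite /group_pi_mul /homotopy_mul !homotopy_classE //.
have class_spherical (c a : gcell G m.+1) :
    @spherical G 1 m.+1 c -> homology_class c a -> @spherical G 1 m.+1 a.
  by move=> Sc [b /boundaries_spherical Sb <-]; apply: sphericalM.
apply/seteqP; split=> [w [a [b [z [Aa Bb zab]]]]|_ [a Aa [b Bb <-]]].
  have Sa := class_spherical _ _ Sx Aa; have Sb := class_spherical _ _ Sy Bb.
  have [c Bc zE] := homotopy_filler_mul G_Kan Sa zab.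
  have Sz : @spherical G 1 m.+1 (a * b * c).
    by do !apply: sphericalM => //; apply: boundaries_spherical.
  rewrite /= zE homotopy_classE // => -[d Bd <-].
  have [b' Bb' bE] := Bb.
  (* The boundaries [c] and [d] are absorbed into the second factor, which stays in the coset of
     [y]. *)
  exists a => //; exists (b * c * d); last by rewrite !mulgA.
  by exists (b' * c * d); rewrite -?bE ?mulgA //; do !apply: boundariesM.
have Sa := class_spherical _ _ Sx Aa; have Sb := class_spherical _ _ Sy Bb.
have [z zab] := homotopy_filler_exists G_Kan Sa Sb.
exists a, b, z; split=> //.
have [c Bc zE] := homotopy_filler_mul G_Kan Sa zab.
have Sz : @spherical G 1 m.+1 (a * b * c).
  by do !apply: sphericalM => //; apply: boundaries_spherical.
(* The face of [z] is [a * b * c], so [c^-1] leads back to [a * b] within its coset. *)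
rewrite /= zE homotopy_classE //; exists c^-1; first exact: boundariesV.
by rewrite -[_ * c * _]mulgA mulgV mulg1.
Qed.
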